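(* Let $A,C,K$ be events with $AK\neq\emptyset$ such that $P(A|K)\geq P(A)$, $P(C|AK)\geq P(C|A)$, and $\mathbb{P}[(C|A)\wedge K]>0$. Then $\mathbb{P}[A|((C|A)\wedge K)]\geq P(A)$.
   Context: Events. An event is a two-valued (true/false) logical entity, identified with its $0/1$ indicator; $\Omega$ and $\emptyset$ are the sure and impossible events, $AB$ denotes $A\wedge B$, and $\overline{A}$ is the negation of $A$. The constituents generated by finitely many events are the non-impossible conjunctions obtained by choosing each event or its negation. An event $E$ is identified with $E|\Omega$. Conditional random quantities. For an event $H\neq\emptyset$ and a finite-valued random quantity $X$ with assessed prevision $\mathbb{P}(X|H)=\mu$, the conditional random quantity $X|H$ is $X|H=XH+\mu\overline{H}$. When $X$ is (the indicator of) an event $A$, $\mathbb{P}(A|H)=P(A|H)$ and $A|H$ is the (indicator of the) conditional event, with values $1$, $0$, $P(A|H)$ according to whether $AH$, $\overline{A}H$, $\overline{H}$ is true. Conjunction. The conjunction $(E_1|H_1)\wedge\cdots\wedge(E_n|H_n)$ is the conditional random quantity, with conditioning event $H_1\vee\cdots\vee H_n$, taking value $1$ if all $E_iH_i$ are true, $0$ if some $\overline{E}_iH_i$ is true, $x_S$ if $(\bigwedge_{i\in S}\overline{H}_i)\wedge(\bigwedge_{i\notin S}E_iH_i)$ is true ($\emptyset\ne S\subsetneq\{1,\dots,n\}$), where $x_S$ is the prevision of $\bigwedge_{i\in S}(E_i|H_i)$, and its own prevision if all $H_i$ are false. Generalized iterated conditional. If $\mathcal{C}_n=(E_1|H_1)\wedge\cdots\wedge(E_n|H_n)$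 is not identically $0$, then $(E_{n+1}|H_{n+1})|\mathcal{C}_n$ is the random quantity $\mathcal{C}_n\wedge(E_{n+1}|H_{n+1})+\mu(1-\mathcal{C}_n)$, where $\mu$ is its own prevision. In the present case, with $x=P(C|A)$: $(C|A)\wedge K$ has values $1$ on $ACK$, $x$ on $\overline{A}K$, $0$ on $A\overline{C}\vee\overline{K}$; $A\wedge(C|A)\wedge K=ACK$; and $A|((C|A)\wedge K)=ACK+\mu(1-(C|A)\wedge K)$ with $\mu=\mathbb{P}[A|((C|A)\wedge K)]$. Coherence. A bet on an object $Z$ with assessed prevision $\mu$ and stake $s\in\mathbb{R}$ has random gain $s(Z-\mu)$. The bet is called off in a constituent if there one receives back the paid amount $\mu$ whatever the value of $\mu$ (for $X|H$: when $\overline{H}$ is true; for a generalized iterated conditional this may depend on the preliminary probability values). An assessment of previsions is coherent if, for every finite subfamily of objects and all real stakes, the total gain $G$, restricted to the constituents in which not all the bets are called off, satisfies $\min G\le 0\le\max G$. Coherent previsions are linear. All probabilities and previsions are assumed to come from a coherent assessment on all objects involved. *)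

(* Defs.v *)
From HB Require Import structures.
From mathcomp Require Import all_boot all_order all_algebra.
From mathcomp Require Import boolp classical_sets reals numfun.

Set Implicit Arguments.
Unset Strict Implicit.
Unset Printing Implicit Defensive.

Import Order.TTheory GRing.Theory Num.Theory.
Local Open Scope classical_set_scope.
Local Open Scope ring_scope.

(* Events are the subsets of a type [T] of elementary cases: [setT] is the sure
   event, [set0] the impossible one, and the constituents generated by finitely
   many events are the nonempty classes of points not separated by them. *)

(* [E |~ H] is the conditional event E|H. *)
Record condEvent (T : Type) := CondEvent { ce_event : set T; ce_cond : set T }.

Notation "E |~ H" := (CondEvent E H) (at level 45, no associativity).

(* An event is identified with the same event conditional on the sure event. *)
Definition sure_cond (T : Type) (E : set T) : condEvent T := E |~ setT.

(* The objects on which previsions are assessed: a conjunction of conditional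
   events (a conditional event being a conjunction with a single conjunct), or
   the iterated conditional of a conditional event given such a conjunction.
   The numerical value of an object depends on the assessed previsions, so
   objects are kept syntactic and interpreted by [value] below. *)
Inductive object (T : Type) :=
| Conj of seq (condEvent T)
| Iter of condEvent T & seq (condEvent T).

Definition cond_obj (T : Type) (E H : set T) : object T := Conj [:: E |~ H].

Definition event_obj (T : Type) (E : set T) : object T := Conj [:: sure_cond E].

(* The conditional random quantity X|H with prevision [m]. *)
Definition cond_rq (R : realType) (T : Type) (X : T -> R) (H : set T) (m : R)
    (w : T) : R :=
  X w * \1_H w + m * \1_(~` H) w.

(* When no conjunct is false and some are void, the conjunction takes as value
   the prevision of the conjunction of the void conjuncts. *)
Definition conj_on (R : realType) (T : Type) (P : object T -> R)
    (s : seq (condEvent T)) (w : T) : R :=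
  if all (fun e => w \in ce_event e `&` ce_cond e) s then 1
  else if has (fun e => w \in ~` ce_event e `&` ce_cond e) s then 0
  else P (Conj [seq e <- s | w \notin ce_cond e]).

Definition conj_value (R : realType) (T : Type) (P : object T -> R)
    (s : seq (condEvent T)) (m : R) : T -> R :=
  cond_rq (conj_on P s) (\big[setU/set0]_(e <- s) ce_cond e) m.

Definition conj_rq (R : realType) (T : Type) (P : object T -> R)
    (s : seq (condEvent T)) : T -> R :=
  conj_value P s (P (Conj s)).

(* The value of [o] as a function of its own prevision [m], the previsions of
   all other objects being given by [P]. *)
Definition value (R : realType) (T : Type) (P : object T -> R) (o : object T)
    (m : R) : T -> R :=
  match o with
  | Conj s => conj_value P s m
  | Iter e s => fun w => conj_rq P (rcons s e) w + m * (1 - conj_rq P s w)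
  end.

(* One receives back the paid amount [m] whatever [m] is. *)
Definition called_off (R : realType) (T : Type) (P : object T -> R)
    (o : object T) (w : T) : Prop :=
  forall m : R, value P o m w = m.

Definition gain (R : realType) (T : Type) (P : object T -> R) (n : nat)
    (o : 'I_n -> object T) (s : 'I_n -> R) (w : T) : R :=
  \sum_(i < n) s i * (value P (o i) (P (o i)) w - P (o i)).

Definition active (R : realType) (T : Type) (P : object T -> R) (n : nat)
    (o : 'I_n -> object T) : set T :=
  [set w | exists i, ~ called_off P (o i) w].

(* Coherence of the assessment [P] on the family [D].  The gain and the set of
   active cases depend only on the constituent containing the point, and the
   gain has finitely many values: "min <= 0 <= max" on the active constituents
   is the existence of active points with gain <= 0 and >= 0.  Repetitions among
   the [o i] are harmless since the corresponding stakes add up. *)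
Definition coherent (R : realType) (T : Type) (P : object T -> R)
    (D : set (object T)) : Prop :=
  forall (n : nat) (o : 'I_n -> object T) (s : 'I_n -> R),
    (forall i, D (o i)) -> active P o !=set0 ->
    (exists2 w, active P o w & gain P o s w <= 0) /\
    (exists2 w, active P o w & 0 <= gain P o s w).

(* Checks that the general definitions give the expected values for conditional
   events, (C|A) /\ K and A|((C|A) /\ K). *)
Lemma value_cond_obj (R : realType) (T : Type) (P : object T -> R)
    (E H : set T) (m : R) (w : T) :
  value P (cond_obj E H) m w = \1_(E `&` H) w + m * \1_(~` H) w.
Proof.
rewrite /= /conj_value /cond_rq /conj_on big_cons big_nil setU0 !indicE /=.
rewrite !in_setI !in_setC.
by case: (w \in E); case: (w \in H); rewrite /= ?(mulr0, mulr1, mul0r, mul1r).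
Qed.

Lemma value_event_obj (R : realType) (T : Type) (P : object T -> R)
    (E : set T) (m : R) (w : T) :
  value P (event_obj E) m w = \1_E w.
Proof.
rewrite [event_obj E]/(cond_obj E setT) value_cond_obj setIT setCT.
by rewrite !indicE in_set0 mulr0 addr0.
Qed.

Lemma value_conj2 (R : realType) (T : Type) (P : object T -> R)
    (A C K : set T) (m : R) (w : T) :
  value P (Conj [:: C |~ A; sure_cond K]) m w =
  \1_(A `&` C `&` K) w + P (cond_obj C A) * \1_(~` A `&` K) w.
Proof.
rewrite /= /conj_value /cond_rq /conj_on !big_cons big_nil !indicE /=.
rewrite !(in_setI, in_setC, in_setU, in_setT, in_set0) /=.
case: (w \in A); case: (w \in C); case: (w \in K);
  by rewrite /= ?(mulr0, mulr1, mul0r, mul1r, addr0, add0r).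
Qed.

Lemma value_iter2 (R : realType) (T : Type) (P : object T -> R)
    (A C K : set T) (m : R) (w : T) :
  value P (Iter (sure_cond A) [:: C |~ A; sure_cond K]) m w =
  \1_(A `&` C `&` K) w +
  m * (1 - (\1_(A `&` C `&` K) w + P (cond_obj C A) * \1_(~` A `&` K) w)).
Proof.
rewrite -(value_conj2 P A C K (P (Conj [:: C |~ A; sure_cond K])) w).
congr (_ + _).
rewrite /= /conj_rq /conj_value /cond_rq /conj_on !big_cons big_nil !indicE /=.
rewrite !(in_setI, in_setC, in_setU, in_setT, in_set0) /=.
case: (w \in A); case: (w \in C); case: (w \in K);
  by rewrite /= ?(mulr0, mulr1, mul0r, mul1r, addr0, add0r).
Qed.

Lemma called_off_cond_obj (R : realType) (T : Type) (P : object T -> R)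
    (E H : set T) (w : T) :
  called_off P (cond_obj E H) w <-> ~ H w.
Proof.
split=> [off Hw | nHw m].
  have := off 2; rewrite value_cond_obj !indicE in_setC (mem_set Hw) mulr0 addr0.
  by move/eqP; rewrite (eqr_nat R); case: (_ \in _).
rewrite value_cond_obj !indicE in_setI in_setC (memNset nHw) andbF.
by rewrite add0r mulr1.
Qed.

(* Main.v *)
Require Import Defs.
From mathcomp Require Import all_boot all_order all_algebra.
From mathcomp Require Import boolp classical_sets reals.
From mathcomp Require Import numfun ring lra.
Import Order.TTheory GRing.Theory Num.Theory.
Local Open Scope classical_set_scope.
Local Open Scope ring_scope.

(** Write [a], [k], [x], [z], [p], [mu] for the previsions of A, A|K, C|A,
    C|AK, (C|A) /\ K and A|((C|A) /\ K), and put [c = z k + x (1 - k)].  If the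
    probability of K were assessed, linearity of prevision would give
    [p = c P(K)] and [mu p = P(ACK) = z k P(K)], so that [p > 0] yields [c > 0]
    and Bayes' formula [mu c = z k].

    Since P(K) is not assessed and the assessment is not extended here, both
    facts are obtained from explicit stakes on C|AK, A|K, (C|A) /\ K and the
    iterated conditional ([conjunction_weight_gt0] and [iterated_bayes]).  A bet
    on (C|A) /\ K reveals the multiple [c K] of the indicator of K, at price
    [p]: enough to cancel the indicator of K from any other combination, which
    leaves a constant gain, and a constant gain must vanish.

    The inequality [a <= mu] is then [a c <= z k], which follows from
    [a <= k <= 1] and [0 <= x <= z]: indeed
    [z k - a c = (z - x) k (1 - a) + x (k - a)]. *)

Section Coherence.
Variables (R : realType) (T : Type) (P : object T -> R) (D : set (object T)).
Hypothesis Pcoherent : coherent P D.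

Lemma cond_obj_bounds (E H : set T) :
  D (cond_obj E H) -> H !=set0 -> 0 <= P (cond_obj E H) <= 1.
Proof.
move=> DEH [w0 Hw0].
have activeE w : active P (fun _ : 'I_1 => cond_obj E H) w <-> H w.
  split=> [[_ on] | Hw]; last by exists ord0; rewrite called_off_cond_obj.
  by apply: contrapT => nHw; apply: on; apply/called_off_cond_obj.
have [|[u /activeE Hu] + [v /activeE Hv]] :=
    Pcoherent _ (fun _ : 'I_1 => cond_obj E H) (fun=> 1) (fun=> DEH).
  by exists w0; apply/activeE.
rewrite /gain !big_ord1 !value_cond_obj !indicE !in_setI !in_setC.
rewrite (mem_set Hu) (mem_set Hv) /= !andbT !mulr0 !addr0 !mul1r.
by case: (u \in E); case: (v \in E) => /= ? ?; lra.
Qed.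

(** The value of (C|A) /\ K with sure K does not involve its own prevision. *)
Lemma conj2_never_called_off (A C K : set T) (w : T) :
  ~ called_off P (Conj [:: C |~ A; sure_cond K]) w.
Proof.
move=> off; have := off 0; rewrite value_conj2 => e0.
have := off 1; rewrite value_conj2 => e1.
by have := oner_neq0 R; rewrite -e1 e0 eqxx.
Qed.

Section Iterated.
Variables A C K : set T.
Let ACgK := Conj [:: C |~ A; sure_cond K].
Let AgACgK := Iter (sure_cond A) [:: C |~ A; sure_cond K].
Let k := P (cond_obj A K).
Let x := P (cond_obj C A).
Let z := P (cond_obj C (A `&` K)).
Let p := P ACgK.
Let mu := P AgACgK.
Let c := z * k + x * (1 - k).

Hypotheses (D_AK : D (cond_obj A K)) (D_CAK : D (cond_obj C (A `&` K))).
Hypotheses (D_conj : D ACgK) (D_iter : D AgACgK).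
Hypothesis T_inhabited : inhabited T.
Hypothesis p_gt0 : 0 < p.

(** Because the bet on (C|A) /\ K is never called off, no case is excluded from
    the coherence condition, even when its stake is zero. *)
Lemma coherent_four_bets (s1 s2 s3 s4 : R) (G : T -> R) :
    (forall w, G w =
       s1 * (\1_(C `&` (A `&` K)) w + z * \1_(~` (A `&` K)) w - z)
     + s2 * (\1_(A `&` K) w + k * \1_(~` K) w - k)
     + s3 * (\1_(A `&` C `&` K) w + x * \1_(~` A `&` K) w - p)
     + s4 * (\1_(A `&` C `&` K) w
             - mu * (\1_(A `&` C `&` K) w + x * \1_(~` A `&` K) w))) ->
  (exists w, G w <= 0) /\ (exists w, 0 <= G w).
Proof.
move=> GE.
pose o : 'I_4 -> object T := tnth
  [tuple cond_obj C (A `&` K); cond_obj A K; ACgK; AgACgK].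
pose s : 'I_4 -> R := tnth [tuple s1; s2; s3; s4].
have Do i : D (o i) by case: i; do 4?[case=> //].
have gainE w : gain P o s w = G w.
  rewrite GE /gain !big_ord_recr big_ord0 /o /s !(tnth_nth (ACgK)) !(tnth_nth 0).
  rewrite [nth _ _ _]/= !value_cond_obj value_conj2 value_iter2.
  rewrite -/x -/z -/k -/p -/mu /=; ring.
have [|[u _ Gu] [v _ Gv]] := Pcoherent _ o s Do.
  case: T_inhabited => w; exists w, (Ordinal (isT : (2 < 4)%N)).
  exact: conj2_never_called_off.
by split; [exists u | exists v]; rewrite -gainE.
Qed.

(** The stakes trade ACK at price [z] per AK, then AK at price [k] per K, so
    that (C|A) /\ K is reduced to [c K] and the gain is [p - c K]. *)
Lemma conjunction_weight_gt0 : 0 < c.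
Proof.
have [|[w]] := coherent_four_bets 1 (z - x) (-1) 0 (fun w => p - c * \1_K w).
  move=> w; rewrite /c !indicE !(in_setI, in_setC).
  by case: (w \in A); case: (w \in C); case: (w \in K) => /=; ring.
by rewrite indicE; case: (w \in K) => /= ? _; have := p_gt0; lra.
Qed.

(** Bayes' formula for A given (C|A) /\ K.  The same trades turn the bet on the
    iterated conditional into [(z k - mu c) K], with no constant term; the bet
    on (C|A) /\ K then replaces [c K] by its price [p]. *)
Lemma iterated_bayes : mu * c = z * k.
Proof.
pose d := z * k - mu * c.
have [|[u du] [_ dv]] := coherent_four_bets
    (c * (mu - 1) + d) (c * (mu * (z - x) - z) + d * (z - x)) (- d) c
    (fun=> d * p).
  move=> w; rewrite /d /c !indicE !(in_setI, in_setC).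
  by case: (w \in A); case: (w \in C); case: (w \in K) => /=; ring.
have : d * p == 0 by rewrite eq_le du dv.
by rewrite mulf_eq0 (gt_eqF p_gt0) orbF subr_eq0 => /eqP ->.
Qed.

End Iterated.
End Coherence.

Theorem mainTheorem7 (R : realType) (T : Type) (A C K : set T)
    (P : object T -> R) (D : set (object T))
    (Pcoherent : coherent P D)
    (D_A : D (event_obj A))
    (D_AK : D (cond_obj A K))
    (D_CA : D (cond_obj C A))
    (D_CAK : D (cond_obj C (A `&` K)))
    (D_conj : D (Conj [:: C |~ A; sure_cond K]))
    (D_iter : D (Iter (sure_cond A) [:: C |~ A; sure_cond K]))
    (AK_possible : A `&` K !=set0)
    (hAK : P (event_obj A) <= P (cond_obj A K))
    (hCAK : P (cond_obj C A) <= P (cond_obj C (A `&` K)))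
    (hconj : 0 < P (Conj [:: C |~ A; sure_cond K])) :
  P (event_obj A) <= P (Iter (sure_cond A) [:: C |~ A; sure_cond K]).
Proof.
case: AK_possible => w [Aw Kw].
have /andP[k_ge0 k_le1] : 0 <= P (cond_obj A K) <= 1.
  by apply: cond_obj_bounds Pcoherent _ _ D_AK _; exists w.
have /andP[x_ge0 _] : 0 <= P (cond_obj C A) <= 1.
  by apply: cond_obj_bounds Pcoherent _ _ D_CA _; exists w.
have c_gt0 := conjunction_weight_gt0 _ _ _ _ Pcoherent _ _ _
  D_AK D_CAK D_conj D_iter (inhabits w) hconj.
have bayes := iterated_bayes _ _ _ _ Pcoherent _ _ _
  D_AK D_CAK D_conj D_iter (inhabits w) hconj.
rewrite -(ler_pM2r c_gt0) bayes -subr_ge0.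
set a := P (event_obj A) in hAK *; set k := P (cond_obj A K) in hAK k_ge0 k_le1 *.
set x := P (cond_obj C A) in hCAK x_ge0 *.
set z := P (cond_obj C (A `&` K)) in hCAK *.
have -> : z * k - a * (z * k + x * (1 - k))
    = (z - x) * (k * (1 - a)) + x * (k - a) by ring.
have a_le1 : a <= 1 := le_trans hAK k_le1.
by rewrite addr_ge0 // !mulr_ge0 // subr_ge0.
Qed.
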